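(* Let $\mathcal{R} = ((M, G, \triangleright), (m_0, \{g_{m_0,m}\}_{m \in M}))$ be a finitely right generated cell space such that the stabiliser $G_0$ of $m_0$ under $\triangleright$ is finite. If $\mathcal{R}$ has sub-exponential growth, then $\mathcal{R}$ is right amenable.
   Context: A \emph{left homogeneous space} is a triple $(M, G, \triangleright)$ where $M$ is a non-empty set, $G$ is a group, and $\triangleright : G \times M \to M$ is a transitive left group action. A \emph{coordinate system} for it is a tuple $(m_0, \{g_{m_0,m}\}_{m\in M})$ with $m_0 \in M$, $g_{m_0,m} \in G$ and $g_{m_0,m} \triangleright m_0 = m$ for each $m \in M$. A left homogeneous space together with a coordinate system is a \emph{cell space}. $G_0$ is the stabiliser of $m_0$, and $G/G_0$ is the set of left cosets $gG_0$, on which $G$ (hence $G_0$) acts by left multiplication, $g \cdot g'G_0 = gg'G_0$. The cell space induces the map $\trianglelefteq : M \times G/G_0 \to M$, $m \trianglelefteq gG_0 = g_{m_0,m}\, g\, g_{m_0,m}^{-1} \triangleright m = g_{m_0,m}\, g \triangleright m_0$. \textbf{Right generating sets.} Let $S \subseteq G/G_0$ with $G_0 \cdot S \subseteq S$. Put $S^{-1} = \{g^{-1}G_0 : s \in S, g \in s\}$. $S$ is a \emph{right generating set} of $\mathcal{R}$ if for each $m \in M$ there are $k \in \mathbb{N}_0$ and $s_1, \dots, s_k \in S \cup S^{-1}$ with $(((m_0 \trianglelefteq s_1) \trianglelefteq s_2) \trianglelefteq \cdots) \trianglelefteq s_k = m$. It is \emph{symmetric} if $S^{-1} \subseteq S$.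 $\mathcal{R}$ is \emph{finitely right generated} if it has a finite right generating set; if in addition $G_0$ is finite, then it has a finite symmetric one. \textbf{Growth.} Let $S$ be a finite symmetric right generating set. The $S$-metric is $d_S(m,m') = \min\{k \in \mathbb{N}_0 : \exists s_1,\dots,s_k \in S,\ (((m \trianglelefteq s_1) \trianglelefteq s_2) \trianglelefteq \cdots) \trianglelefteq s_k = m'\}$, $\mathbb{B}_S(k) = \{m \in M : d_S(m_0,m) \le k\}$, and $\gamma_S : \mathbb{N}_0 \to \mathbb{N}_0$, $\gamma_S(k) = |\mathbb{B}_S(k)|$. For non-decreasing maps $\gamma, \gamma' : \mathbb{N}_0 \to \mathbb{R}_{\ge 0}$ (growth functions), $\gamma$ \emph{dominates} $\gamma'$ if there is a positive integer $\alpha$ with $\alpha \gamma(\alpha k) \ge \gamma'(k)$ for all positive integers $k$; $\gamma$ and $\gamma'$ are \emph{equivalent} if each dominates the other. The \emph{growth type} $\gamma(\mathcal{R})$ is the equivalence class of $\gamma_S$ (it does not depend on $S$). $\mathcal{R}$ has \emph{exponential growth} if $\gamma(\mathcal{R})$ is the equivalence class of $\exp$ (that is, $k \mapsto e^k$), and \emph{sub-exponential growth} otherwise. \textbf{Right amenability.} $\mathcal{R}$ is \emph{right amenable} if there is a finitely additive probability measure $\mu$ on the power set of $M$ such that for each $\mathfrak{g} \in G/G_0$ and each $A \subseteq M$ such that the map $A \to M$, $m \mapsto m \trianglelefteq \mathfrak{g}$, is injective, we have $\mu(A \trianglelefteq \mathfrak{g}) = \mu(A)$, where $A \trianglelefteq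 \mathfrak{g} = \{a \trianglelefteq \mathfrak{g} : a \in A\}$. *)

(* Defs.v *)
From HB Require Import structures.
From mathcomp Require Import all_boot all_order all_algebra.
From mathcomp Require Import finmap.
From mathcomp Require Import boolp classical_sets functions cardinality.
From mathcomp Require Import reals sequences exp.
Set Implicit Arguments.
Unset Strict Implicit.
Unset Printing Implicit Defensive.
Import Order.TTheory GRing.Theory Num.Theory.
Local Open Scope classical_set_scope.

Record left_homogeneous_space := LeftHomogeneousSpace {
  carrier : choiceType;
  acting_group : groupType;
  act : acting_group -> carrier -> carrier;
  carrier_nonempty : inhabited carrier;
  act1 : forall m, act 1%g m = m;
  actM : forall g h m, act (g * h)%g m = act g (act h m);
  act_transitive : forall m m', exists g, act g m = m' }.

Record cell_space := CellSpace {
  homogeneous_space :> left_homogeneous_space;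
  origin : carrier homogeneous_space;
  coordinate : carrier homogeneous_space -> acting_group homogeneous_space;
  coordinateP : forall m, act (coordinate m) origin = m }.

Section CellSpace.
Variable C : cell_space.
Notation M := (carrier C).
Notation G := (acting_group C).
Notation m0 := (origin C).
Implicit Types (m : M) (g h : G) (s : set G) (S T : set (set G)).

Definition stabiliser : set G := [set g | act g m0 = m0].

(* Elements of G / G_0 are subsets of G, and subsets of G / G_0 are sets of
   subsets of G *)
Definition lcoset g : set G := [set (g * h)%g | h in stabiliser].

Definition cosets : set (set G) := range lcoset.

Definition ltranslate g s : set G := [set (g * h)%g | h in s].

(* [xget 1 s] is an arbitrary element of [s]; for s in G / G_0 the result does
   not depend on it, see [ract_lcoset] and [ract_lcosetE] *)
Definition ract m s : M :=
  let g := xget 1%g s in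
  act (coordinate m * g * (coordinate m)^-1)%g m.

Definition inv_cosets S : set (set G) :=
  [set t | exists s g, [/\ S s, s g & t = lcoset g^-1%g]].

(* [m'] is obtained from [m] by [k] successive right actions of elements of
   [S] *)
Definition reach S (k : nat) m m' : Prop :=
  exists w : seq (set G), [/\ size w = k, [set` w] `<=` S & foldl ract m w = m'].

Definition right_generating_set S : Prop :=
  [/\ S `<=` cosets,
      forall g s, stabiliser g -> S s -> S (ltranslate g s) &
      forall m, exists k, reach (S `|` inv_cosets S) k m0 m].

Definition symmetric_cosets S : Prop := inv_cosets S `<=` S.

Definition finitely_right_generated : Prop :=
  exists S, finite_set S /\ right_generating_set S.

Definition finite_symmetric_right_generating_set S : Prop :=
  [/\ finite_set S, right_generating_set S & symmetric_cosets S].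

(* Least [k] with [reach S k m m']; such a [k] exists when [S] is a symmetric
   right generating set (see [distP] and [reach_total]), and the value is the
   default 0 when there is none *)
Definition dist S m m' : nat :=
  xget 0%N [set k | reach S k m m' /\ forall j, reach S j m m' -> (k <= j)%N].

Definition ball S (k : nat) : set M := [set m | (dist S m0 m <= k)%N].

Definition ball_size S (k : nat) : nat := #|` fset_set (ball S k)|.

End CellSpace.

Arguments stabiliser : clear implicits.
Arguments cosets : clear implicits.

Section Growth.
Variable R : realType.
Implicit Type gamma : nat -> R.
Local Open Scope ring_scope.

Definition growth_function gamma : Prop :=
  (forall k, 0 <= gamma k) /\ (forall j k, (j <= k)%N -> gamma j <= gamma k).

Definition dominates gamma gamma' : Prop :=
  exists2 a : nat, (0 < a)%N &
    forall k : nat, (0 < k)%N -> gamma' k <= a%:R * gamma (a * k)%N.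

Definition growth_equivalent gamma gamma' : Prop :=
  dominates gamma gamma' /\ dominates gamma' gamma.

Definition growth_class gamma : set (nat -> R) :=
  [set gamma' | growth_function gamma' /\ growth_equivalent gamma gamma'].

Definition growth (C : cell_space) (S : set (set (acting_group C))) : nat -> R :=
  fun k => (ball_size S k)%:R.

(* The union of the classes of the growth functions [growth S]; by
   [growth_typeE] all of these classes are equal *)
Definition growth_type (C : cell_space) : set (nat -> R) :=
  [set gamma | exists2 S : set (set (acting_group C)),
     finite_symmetric_right_generating_set S & growth_class (growth S) gamma].

Definition exponential_growth (C : cell_space) : Prop :=
  growth_type C = growth_class (fun k => expR k%:R).

Definition subexponential_growth (C : cell_space) : Prop :=
  ~ exponential_growth C.

Record finitely_additive_probability (T : Type) (mu : set T -> R) : Prop := {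
  fap_ge0 : forall A, 0 <= mu A;
  fap_setT : mu setT = 1;
  fap_additive : forall A B,
    A `&` B = set0 -> mu (A `|` B) = mu A + mu B }.

Definition right_amenable (C : cell_space) : Prop :=
  exists2 mu : set (carrier C) -> R, finitely_additive_probability mu &
    forall s : set (acting_group C), cosets C s ->
    forall A : set (carrier C), set_inj A (fun m => ract m s) ->
      mu ((fun m => ract m s) @` A) = mu A.

End Growth.

Arguments growth_type : clear implicits.

Section CellSpaceTheory.
Variable C : cell_space.
Notation M := (carrier C).
Notation G := (acting_group C).
Notation m0 := (origin C).
Implicit Types (m : M) (g h : G) (s : set G) (S T : set (set G)).

Lemma act_coordinateV m : act (coordinate m)^-1%g m = m0.
Proof. by rewrite -{2}(coordinateP m) -actM mulVg act1. Qed.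

Lemma xget_lcoset g : exists2 h, stabiliser C h & xget 1%g (lcoset g) = (g * h)%g.
Proof.
have [|h hh <-] := @xgetPex _ 1%g (lcoset g); last by exists h.
by exists (g * 1)%g; exists 1%g => //; exact: act1.
Qed.

Lemma ract_lcosetE m g : ract m (lcoset g) = act (coordinate m * g)%g m0.
Proof.
have [h hh E] := xget_lcoset g.
by rewrite /ract E/= actM act_coordinateV mulgA [LHS]actM hh.
Qed.

Lemma ract_lcoset m g :
  ract m (lcoset g) = act (coordinate m * g * (coordinate m)^-1)%g m.
Proof. by rewrite ract_lcosetE [RHS]actM act_coordinateV. Qed.

Lemma ltranslate_lcoset g h : ltranslate g (lcoset h) = lcoset (g * h)%g.
Proof.
apply/seteqP; split=> [_ [_ [k hk <-] <-]|_ [k hk <-]].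
  by exists k => //; rewrite mulgA.
by exists (h * k)%g; [exists k | rewrite mulgA].
Qed.

Lemma act_ract g m s : cosets C s ->
  exists2 h, stabiliser C h & act g (ract m s) = ract (act g m) (ltranslate h s).
Proof.
move=> [k _ <-]; exists ((coordinate (act g m))^-1 * (g * coordinate m))%g.
  by rewrite /stabiliser/= 2!actM coordinateP act_coordinateV.
by rewrite ltranslate_lcoset !ract_lcosetE -actM !mulgA mulgV mul1g.
Qed.

Lemma reach0 S m : reach S 0 m m.
Proof. by exists [::]. Qed.

Lemma reachD S j k m1 m2 m3 :
  reach S j m1 m2 -> reach S k m2 m3 -> reach S (j + k) m1 m3.
Proof.
move=> [v [<- vS <-]] [w [<- wS <-]]; exists (v ++ w).
rewrite size_cat foldl_cat; split=> // s /=; rewrite mem_cat => /orP[/vS|/wS] //.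
Qed.

Lemma reachS S k m m' :
  reach S k.+1 m m' <-> exists2 m1, reach S k m m1 & exists2 s, S s & ract m1 s = m'.
Proof.
split=> [[w [sw wS <-]]|[m1 [w [sw wS <-]] [s Ss <-]]].
  case/lastP: w sw wS => [//|w s]; rewrite size_rcons => -[sw] wS.
  exists (foldl (@ract C) m w).
    by exists w; split=> // t /= tw; apply: wS; rewrite /= mem_rcons inE tw orbT.
  by exists s; [apply: wS; rewrite /= mem_rcons mem_head | rewrite foldl_rcons].
exists (rcons w s); rewrite size_rcons sw foldl_rcons; split=> // t /=.
by rewrite mem_rcons inE => /orP[/eqP ->|/wS].
Qed.

Lemma reach_act S k g m m' : S `<=` cosets C ->
  (forall h s, stabiliser C h -> S s -> S (ltranslate h s)) ->
  reach S k m m' -> reach S k (act g m) (act g m').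
Proof.
move=> SC SG; elim: k m' => [|k IHk] m'.
  by move=> [w [/size0nil -> _ <-]]; exact: reach0.
move=> /reachS[m1 /IHk r1 [s Ss <-]]; apply/reachS; exists (act g m1) => //.
by have [h hh ->] := act_ract g m1 (SC _ Ss); exists (ltranslate h s); first exact: SG.
Qed.

Lemma reach_sub S T k m m' : S `<=` T -> reach S k m m' -> reach T k m m'.
Proof. by move=> ST [w [sw wS wm]]; exists w; split=> // s /wS /ST. Qed.

Lemma reach_total S m m' : right_generating_set S -> symmetric_cosets S ->
  exists k, reach S k m m'.
Proof.
move=> [SC SG Sgen] Ssym.
have [k rk] := Sgen (act (coordinate m)^-1%g m').
have {}rk : reach S k m0 (act (coordinate m)^-1%g m').
  by apply: reach_sub rk => s [|/Ssym].
exists k; have := reach_act (coordinate m) SC SG rk.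
by rewrite coordinateP -actM mulgV act1.
Qed.

Lemma distP S k m m' : reach S k m m' ->
  reach S (dist S m m') m m' /\ (dist S m m' <= k)%N.
Proof.
move=> rk; have ex : exists j, `[< reach S j m m' >] by exists k; apply/asboolP.
have : [set j | reach S j m m' /\ forall i, reach S i m m' -> (j <= i)%N]
    (ex_minn ex).
  case: ex_minnP => j /asboolP rj jmin; split=> // i ri.
  by apply: jmin; apply/asboolP.
by move=> H; have [r /(_ _ rk)] := xgetPex 0%N (ex_intro _ _ H).
Qed.

Lemma ballP S k m : right_generating_set S -> symmetric_cosets S ->
  ball S k m <-> exists2 j, (j <= k)%N & reach S j m0 m.
Proof.
move=> Sgen Ssym; split=> [Bm|[j jk /distP[_ dj]]]; last exact: leq_trans jk.
have [j /distP[rj _]] := reach_total m0 m Sgen Ssym.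
by exists (dist S m0 m).
Qed.

Lemma finite_ball S k : finite_symmetric_right_generating_set S ->
  finite_set (ball S k).
Proof.
move=> [Sfin Sgen Ssym].
suff fin j : finite_set [set m | reach S j m0 m].
  have := @bigcup_finite _ _ `I_k.+1 (fun j => [set m | reach S j m0 m])
    (finite_II _) (fun j _ => fin j).
  apply: sub_finite_set => m /(ballP _ _ Sgen Ssym)[j jk rj].
  by exists j => //=; rewrite ltnS.
elim: j => [|j IHj].
  apply: sub_finite_set (finite_set1 m0) => m [w [/size0nil -> _ <-]] //.
apply: sub_finite_set (finite_image2 (@ract C) IHj Sfin) => m.
by move=> /reachS[m1 r1 [s Ss <-]]; exists m1 => //; exists s.
Qed.

Lemma ball_sub S T : finite_symmetric_right_generating_set S ->
  finite_symmetric_right_generating_set T ->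
  exists2 a, (0 < a)%N & forall k, ball T k `<=` ball S (a * k).
Proof.
move=> [_ Sgen Ssym] [Tfin Tgen Tsym].
have [f fP] := boolp.choice (fun t => reach_total m0 (ract m0 t) Sgen Ssym).
have [a fa] : exists a, forall t, T t -> (f t <= a)%N.
  exists (\max_(t <- fset_set T) f t)%N => t Tt.
  by apply: leq_bigmax_seq => //; rewrite in_fset_set // inE.
have [SC SG _] := Sgen; have [TC TG _] := Tgen.
have step m t : T t -> exists2 j, (j <= a)%N & reach S j m (ract m t).
  move=> Tt; have [h hh E] := act_ract (coordinate m)^-1%g m (TC _ Tt).
  exists (f (ltranslate h t)); first exact: (fa _ (TG _ _ hh Tt)).
  have := reach_act (coordinate m) SC SG (fP (ltranslate h t)).
  rewrite coordinateP.
  by move: E; rewrite act_coordinateV => <-; rewrite -actM mulgV act1.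
exists a.+1 => // k m /(ballP _ _ Tgen Tsym)[j jk rj].
suff [i ij ri] : exists2 i, (i <= a.+1 * j)%N & reach S i m0 m.
  apply/(ballP _ _ Sgen Ssym); exists i => //.
  by rewrite (leq_trans ij) // leq_mul2l jk orbT.
elim: j m rj {jk} => [|j IHj] m.
  by move=> [w [/size0nil -> _ <-]]; exists 0%N => //; exact: reach0.
move=> /reachS[m1 /IHj[i ij r1] [t Tt <-]].
have [l la rl] := step m1 t Tt; exists (i + l)%N; last exact: reachD rl.
by rewrite mulnS addnC leq_add // leqW.
Qed.

End CellSpaceTheory.

Section GrowthTheory.
Variables (R : realType) (C : cell_space).
Implicit Types (S T : set (set (acting_group C))) (gamma : nat -> R).
Local Open Scope ring_scope.

Lemma growth_functionS S : finite_symmetric_right_generating_set S ->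
  growth_function (growth R S).
Proof.
move=> Sf; split=> [k|j k jk]; rewrite /growth ?ler_nat ?ler0n //.
apply: fsubset_leq_card; rewrite -fset_set_sub; [|exact: finite_ball..].
by move=> m /= /leq_trans; apply.
Qed.

Lemma growth_function_expR : growth_function (fun k => expR k%:R : R).
Proof.
by split=> [k|j k jk]; [exact: expR_ge0 | rewrite ler_expR ler_nat].
Qed.

Lemma dominates_trans gamma1 gamma2 gamma3 :
  dominates gamma1 gamma2 -> dominates gamma2 gamma3 -> dominates gamma1 gamma3.
Proof.
move=> [a a0 H12] [b b0 H23]; exists (b * a)%N; first by rewrite muln_gt0 b0.
move=> k k0; apply: le_trans (H23 k k0) _.
rewrite natrM -mulrA ler_wpM2l // (le_trans (H12 _ _)) ?muln_gt0 ?b0 //.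
by rewrite mulnA (mulnC a b).
Qed.

Lemma growth_equivalentS S T : finite_symmetric_right_generating_set S ->
  finite_symmetric_right_generating_set T ->
  growth_equivalent (growth R S) (growth R T).
Proof.
suff dom (U V : set (set (acting_group C))) : finite_symmetric_right_generating_set U ->
    finite_symmetric_right_generating_set V ->
    dominates (growth R U) (growth R V).
  by move=> SF TF; split; exact: dom.
move=> UF VF; have [a a0 sub] := ball_sub UF VF; exists a => // k _.
rewrite /growth -natrM ler_nat.
have le1 : (ball_size V k <= ball_size U (a * k))%N.
  apply: fsubset_leq_card; rewrite -fset_set_sub; [|exact: finite_ball..].
  exact: sub.
by apply: leq_trans le1 _; rewrite leq_pmull.
Qed.

Lemma growth_typeE S : finite_symmetric_right_generating_set S ->
  growth_type R C = growth_class (growth R S).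
Proof.
move=> SF; apply/seteqP; split=> [gamma [T TF [gf [d1 d2]]]|gamma]; last by exists S.
have [ST TS] := growth_equivalentS SF TF.
by split=> //; split; [exact: dominates_trans ST d1 | exact: dominates_trans d2 TS].
Qed.

End GrowthTheory.

(* Main.v *)
(** A subexponential ball growth [gamma] cannot satisfy
    [gamma (k + n) > (1 + 1/(n+1)) * gamma k] for every [k], so for each [n] some
    ball [F_n] of radius [k_n] is nearly as large as the ball of radius
    [k_n + n].  As the stabiliser is finite, right multiplication by a fixed
    coset displaces all points by a bounded distance, so when it is injective
    on [A] it changes the number of points of [A] in [F_n] by at most the size
    of that shell.  A limit of the normalised counting measures of the [F_n]
    along an ultrafilter is therefore an invariant mean. *)
Require Import Defs.
From mathcomp Require Import all_boot all_order all_algebra.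
From mathcomp Require Import finmap.
From mathcomp Require Import boolp classical_sets functions cardinality reals.
From mathcomp Require Import filter topology normedtype sequences exp.
Set Implicit Arguments.
Unset Strict Implicit.
Unset Printing Implicit Defensive.
Import Order.TTheory GRing.Theory Num.Theory.
Import numFieldNormedType.Exports.
Local Open Scope classical_set_scope.

Local Notation card A := #|` fset_set A|.
Local Notation ball := Defs.ball.

(** * Counting in finite sets *)

Section Cardinal.
Variable T : choiceType.
Implicit Types A B D : set T.

Lemma card_subset A B : finite_set B -> A `<=` B -> (card A <= card B)%N.
Proof.
move=> Bf AB; apply: fsubset_leq_card; rewrite -fset_set_sub //.
exact: sub_finite_set Bf.
Qed.

Lemma card_setU_le A B : finite_set A -> finite_set B ->
  (card (A `|` B) <= card A + card B)%N.
Proof. by move=> Af Bf; rewrite fset_setU // cardfsU leq_subr. Qed.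

Lemma card_setU_disj A B : finite_set A -> finite_set B -> A `&` B = set0 ->
  card (A `|` B) = (card A + card B)%N.
Proof.
move=> Af Bf AB; rewrite fset_setU // cardfsU -fset_setI // AB fset_set0.
by rewrite cardfs0 subn0.
Qed.

Lemma card_setD A B : finite_set B -> A `<=` B ->
  card (B `\` A) = (card B - card A)%N.
Proof.
move=> Bf AB; have Af := sub_finite_set AB Bf.
by rewrite fset_setD // cardfsDS // -fset_set_sub.
Qed.

Lemma card_image_le (T' : choiceType) (f : T -> T') A : finite_set A ->
  (card (f @` A) <= card A)%N.
Proof. by move=> Af; rewrite fset_set_image // leq_imfset_card. Qed.

Lemma card_image_inj (T' : choiceType) (f : T -> T') A : finite_set A ->
  set_inj A f -> card (f @` A) = card A.
Proof.
move=> Af fi; rewrite fset_set_image //; apply: card_in_imfset => x y.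
by rewrite !in_fset_set // => xA yA; apply: fi.
Qed.

Lemma card_image2_le (T' U : choiceType) (f : T -> T' -> U) A (B : set T') :
  finite_set A -> finite_set B ->
  (card [set f x y | x in A & y in B] <= card A * card B)%N.
Proof.
move=> Af Bf; rewrite -(size_allpairs f); apply: uniq_leq_size => [|z].
  exact: fset_uniq.
rewrite in_fset_set ?inE; last exact: finite_image2.
move=> [x Ax [y By <-]]; apply/allpairsP; exists (x, y) => /=.
by rewrite !in_fset_set // !inE.
Qed.

(** Along [f], a point of [A] can leave or enter [B] only through the shell [D] minus [B].
    Injectivity ensures that a point leaving [B] is charged to its own point of the shell. *)
Lemma card_image_setI (f : T -> T) A B D : finite_set D -> B `<=` D ->
  set_inj A f -> (forall x, A x -> B x -> D (f x)) ->
  (forall x, A x -> B (f x) -> D x) ->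
  (card (A `&` B) <= card (f @` A `&` B) + (card D - card B))%N /\
  (card (f @` A `&` B) <= card (A `&` B) + (card D - card B))%N.
Proof.
move=> Df BD fi BfD fBD; have Bf := sub_finite_set BD Df.
have If E : finite_set (E `&` B) by apply: finite_setIr.
have Sf : finite_set (D `\` B) by apply: finite_setD.
rewrite -card_setD //; split.
  rewrite -(@card_image_inj _ f) //; last first.
    by move=> x y; rewrite !inE => -[xA _] [yA _]; apply: fi; rewrite inE.
  apply: leq_trans (card_setU_le (If _) Sf); apply: card_subset.
    by rewrite finite_setU.
  move=> _ [x [Ax Bx] <-]; have [Bfx|nBfx] := pselect (B (f x)).
    by left; split=> //; exists x.
  by right; split=> //; exact: BfD.
(* Here preimages are counted: each point of the image in [B] comes from [A] within [B] or from the
   shell. *)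
apply: leq_trans (card_setU_le (If _) Sf).
have Uf : finite_set (A `&` B `|` D `\` B) by rewrite finite_setU.
apply: leq_trans (card_image_le f Uf); apply: card_subset.
  exact: finite_image.
move=> _ [[x Ax <-] Bfx]; exists x => //.
have [Bx|nBx] := pselect (B x); first by left.
by right; split=> //; exact: fBD.
Qed.

End Cardinal.

(** * Ultrafilter limits of normalised counting measures *)

Lemma ultra_fmap (T T' : Type) (f : T -> T') (F : set_system T) :
  UltraFilter F -> UltraFilter (f @ F).
Proof.
move=> FU; split=> [|G GP FG]; first exact: fmap_proper_filter.
apply/seteqP; split=> // A GA.
(* [F] decides the preimage of [A]; were its complement in [F], the proper filter [G] would contain
   both [A] and its complement. *)
have [//|/(FG (~` A)) GnA] := in_ultra_setVsetC (f @^-1` A) FU.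
have [x [Ax nAx]] : (A `&` ~` A) !=set0.
  by apply: (@filter_ex _ G); exact: filterI.
by have := nAx Ax.
Qed.

Section Mean.
Variables (R : realType) (T : choiceType) (F : nat -> set T).
Hypothesis F_finite : forall n, finite_set (F n).
Hypothesis F_neq0 : forall n, F n !=set0.
Local Open Scope ring_scope.

Definition density (n : nat) (A : set T) : R :=
  (card (A `&` F n))%:R / (card (F n))%:R.

Lemma card_F_gt0 n : 0 < (card (F n))%:R :> R.
Proof.
have [x Fx] := F_neq0 n; rewrite ltr0n cardfs_gt0; apply/fset0Pn; exists x.
by rewrite in_fset_set // inE.
Qed.

Lemma density_ge0 n A : 0 <= density n A.
Proof. by rewrite divr_ge0. Qed.

Lemma density_le1 n A : density n A <= 1.
Proof.
rewrite ler_pdivrMr ?card_F_gt0 // mul1r ler_nat.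
by apply: card_subset => // x [].
Qed.

Lemma densityT n : density n setT = 1.
Proof. by rewrite /density setTI divff // lt0r_neq0 // card_F_gt0. Qed.

Lemma densityU n A B : A `&` B = set0 ->
  density n (A `|` B) = density n A + density n B.
Proof.
move=> AB; rewrite /density setIUl card_setU_disj ?natrD ?mulrDl //.
- exact: finite_setIr.
- exact: finite_setIr.
- by rewrite setIACA AB set0I.
Qed.

(** All densities lie in the compact interval [0, 1], so each has a limit along one fixed
    ultrafilter [U], and the axioms of a mean pass to limits. Since [U] refines [\oo], ordinary
    limits of densities are also limits along [U]. *)
Lemma density_limit_mean : exists mu : set T -> R,
  finitely_additive_probability mu /\
  forall A B, density n A - density n B @[n --> \oo] --> (0 : R) -> mu A = mu B.
Proof.
have [U [U_ultra ooU]] := ultraFilterLemma (F := \oo) _.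
have U_proper : ProperFilter U by exact: ultra_proper.
have lim_ex A : exists l : R, density n A @[n --> U] --> l.
  have := @segment_compact R 0 1; rewrite compact_ultra => /= cpt.
  have U01 : (density n A @[n --> U]) `[0, 1]%classic.
    by apply: (@filterE _ U) => n; rewrite /= in_itv /= density_ge0 density_le1.
  by have [l [_ dl]] := cpt _ (ultra_fmap _ U_ultra) U01; exists l.
have [mu muP] := boolp.choice lim_ex; exists mu; split=> [|A B AB].
  split=> [A||A B AB].
  - apply: (closed_cvg _ (@closed_ge R 0)) (muP A).
    by apply: filterE => n; exact: density_ge0.
  - apply: (cvg_unique _ (muP setT)) => //.
    rewrite (_ : density^~ setT = fun=> 1); last first.
      by apply/funext => n; exact: densityT.
    exact: cvg_cst.
  - apply: (cvg_unique _ (muP _)) => //.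
    rewrite (_ : density^~ _ = fun n => density n A + density n B); last first.
      by apply/funext => n; exact: densityU.
    exact: cvgD (muP A) (muP B).
apply/eqP; rewrite -subr_eq0; apply/eqP.
apply: (cvg_unique _ (cvgB (muP A) (muP B))) => //.
by apply: cvg_trans AB; exact: cvg_app ooU.
Qed.

End Mean.

(** * Symmetric generating sets *)

Section CellSpace.
Variable C : cell_space.
Notation G := (acting_group C).
Notation m0 := (origin C).
Implicit Types (S : set (set G)).

Lemma lcoset_stabiliserM g h : stabiliser C h -> lcoset (g * h)%g = lcoset g.
Proof.
move=> hh; apply/seteqP; split=> [_ [k kk <-]|_ [k kk <-]].
  by exists (h * k)%g; rewrite ?mulgA // /stabiliser/= actM kk.
exists (h^-1 * k)%g; last by rewrite mulgA mulgK.
by rewrite /stabiliser/= actM kk -{1}hh -actM mulVg act1.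
Qed.

(** Adjoining the inverse cosets keeps [S] finite because each coset has as many elements as the
    finite stabiliser, at most one inverse coset arising from each. *)
Lemma finite_symmetric_generation : finitely_right_generated C ->
  finite_set (stabiliser C) ->
  exists S : set (set G), finite_symmetric_right_generating_set S.
Proof.
move=> [S [Sf [SC SG Sgen]]] stabf; exists (S `|` inv_cosets S).
have stabV h : stabiliser C h -> stabiliser C h^-1%g.
  by move=> hh; rewrite /stabiliser/= -{1}hh -actM mulVg act1.
split; [|split|].
- rewrite finite_setU; split=> //.
  suff : finite_set (\bigcup_(s in S) [set lcoset g^-1%g | g in s]).
    by apply: sub_finite_set => _ [s [g [Ss sg ->]]]; exists s => //; exists g.
  apply: bigcup_finite => // s /SC[g _ <-].
  by apply: finite_image; exact: finite_image.
- by move=> s [/SC //|[t [g [_ _ ->]]]]; exists g^-1%g.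
- move=> h s hh [Ss|[t [g [St tg ->]]]]; first by left; exact: SG.
  (* The translate by [h] of the coset of [g^-1] is the coset of the inverse of [g * h^-1], which
     still lies in [t]. *)
  right; exists t, (g * h^-1)%g; split=> //; last first.
    by rewrite ltranslate_lcoset invgM invgK.
  have [k _ E] := SC _ St; move: tg; rewrite -E => -[l ll <-].
  exists (l * h^-1)%g; last by rewrite mulgA.
  by rewrite /stabiliser/= actM (stabV _ hh).
- move=> m; have [k rk] := Sgen m; exists k.
  by apply: reach_sub rk => s ?; left.
- move=> _ [s [g [[Ss|[t [k [St tk E]]]] sg ->]]].
    by right; exists s, g.
  (* An element of the coset of [k^-1] is [k^-1 * h] with [h] in the stabiliser. The coset of its
     inverse is the translate by [h^-1] of the coset of [k], which is in [S]. *)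
  left; move: sg; rewrite E => -[h hh <-].
  rewrite invgM invgK -ltranslate_lcoset; apply: SG; first exact: stabV.
  have [l _ El] := SC _ St; move: tk; rewrite -El => -[j jj <-].
  by rewrite lcoset_stabiliserM // El.
Qed.

(** * Balls and displacements *)

Section Balls.
Variable S : set (set G).
Hypothesis S_fsrg : finite_symmetric_right_generating_set S.

Let Sf : finite_set S. Proof. by have [] := S_fsrg. Qed.
Let Sgen : right_generating_set S. Proof. by have [] := S_fsrg. Qed.
Let Ssym : symmetric_cosets S. Proof. by have [] := S_fsrg. Qed.
Let SC : S `<=` cosets C. Proof. by have [] := Sgen. Qed.

Lemma sub_ball j k : (j <= k)%N -> ball S j `<=` ball S k.
Proof. by move=> jk m /= /leq_trans; apply. Qed.

Lemma ball_reach j k n m m' : ball S k m -> reach S j m m' -> (j <= n)%N ->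
  ball S (k + n) m'.
Proof.
move=> /(ballP _ _ Sgen Ssym)[i ik ri] rj jn.
apply/(ballP _ _ Sgen Ssym).
by exists (i + j)%N; [exact: leq_add | exact: reachD rj].
Qed.

Lemma ball_origin k : ball S k m0.
Proof. by apply/(ballP _ _ Sgen Ssym); exists 0%N => //; exact: reach0. Qed.

Lemma ball_size_gt0 k : (0 < ball_size S k)%N.
Proof.
rewrite cardfs_gt0; apply/fset0Pn; exists m0.
by rewrite in_fset_set ?inE; [exact: ball_origin | exact: finite_ball].
Qed.

Lemma ball_size_le_exp k : (ball_size S k <= (card S).+1 ^ k)%N.
Proof.
elim: k => [|k IHk].
  rewrite expn0 -(cardfs1 m0) -fset_set1; apply: card_subset => //.
  move=> m /(ballP _ _ Sgen Ssym)[j]; rewrite leqn0 => /eqP ->.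
  by move=> [w [/size0nil -> _ <-]].
have Bf := finite_ball k S_fsrg.
have If := finite_image2 (@ract C) Bf Sf.
apply: (@leq_trans (ball_size S k + ball_size S k * card S)).
  apply: leq_trans (leq_add (leqnn _) (card_image2_le (@ract C) Bf Sf)).
  apply: leq_trans (card_setU_le Bf If); apply: card_subset.
    by rewrite finite_setU.
  (* A nonempty word is cut before its last letter; the empty word is why the smaller ball itself
     appears in the union. *)
  move=> m /(ballP _ _ Sgen Ssym)[[|j] jk rj].
    by left; apply/(ballP _ _ Sgen Ssym); exists 0%N.
  move: rj => /reachS[m1 r1 [s Ss <-]]; right; exists m1; last by exists s.
  by apply/(ballP _ _ Sgen Ssym); exists j.
by rewrite -mulnS expnS mulnC leq_mul2l IHk orbT.
Qed.

(** Moving [m] back to the origin turns the action of [s] into that of a translate of [s] by a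
    stabiliser element depending on [m]. Only finitely many translates occur, so the maximum of
    their path lengths, in both directions, works for all [m]. *)
Lemma bounded_displacement s : finite_set (stabiliser C) -> cosets C s ->
  exists n, forall m, (exists2 j, (j <= n)%N & reach S j m (ract m s)) /\
                      (exists2 j, (j <= n)%N & reach S j (ract m s) m).
Proof.
move=> stabf sC; have [_ SG _] := Sgen.
have [f fP] := boolp.choice (fun m => reach_total m0 m Sgen Ssym).
have [g gP] := boolp.choice (fun m => reach_total m m0 Sgen Ssym).
pose P h := ract m0 (ltranslate h s).
pose N h := maxn (f (P h)) (g (P h)).
exists (\max_(h <- fset_set (stabiliser C)) N h)%N => m.
have [h hh] := act_ract (coordinate m)^-1%g m sC.
rewrite act_coordinateV => E.
have {}E : ract m s = act (coordinate m) (P h) by rewrite /P -E -actM mulgV act1.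
have Nh : (N h <= \max_(h <- fset_set (stabiliser C)) N h)%N.
  by apply: leq_bigmax_seq => //; rewrite in_fset_set // inE.
rewrite E -{1 4}(coordinateP m); split.
  exists (f (P h)); first exact: leq_trans (leq_maxl _ _) Nh.
  exact: reach_act.
exists (g (P h)); first exact: leq_trans (leq_maxr _ _) Nh.
exact: reach_act.
Qed.

(** * Sub-exponential growth and thin shells *)

Section Growth.
Variable R : realType.
Local Open Scope ring_scope.
Local Notation gamma := (growth R S).

Lemma exp_dominates_growth : dominates (fun k => expR k%:R : R) gamma.
Proof.
exists (card S).+1 => // k _; set a := (card S).+1.
apply: (@le_trans _ _ (a%:R ^+ k)).
  by rewrite /growth -natrX ler_nat ball_size_le_exp.
apply: (@le_trans _ _ (expR (a * k)%N%:R)); last by rewrite ler_peMl ?expR_ge0 ?ler1n.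
(* It remains to compare the bases: [a <= 1 + a <= expR a]. *)
rewrite natrM expRM_natr lerXn2r ?nnegrE ?expR_ge0 //.
by apply: le_trans (expR_ge1Dx _); rewrite lerDr.
Qed.

(** As [exp] always dominates [gamma], the reverse domination would make their growth classes
    equal. *)
Lemma subexponential_not_dominates : subexponential_growth R C ->
  ~ dominates gamma (fun k => expR k%:R).
Proof.
move=> sub dom; apply: sub; rewrite /exponential_growth (growth_typeE R S_fsrg).
apply/seteqP; split=> x [xg [d1 d2]]; split=> //; split.
- exact: dominates_trans exp_dominates_growth d1.
- exact: dominates_trans d2 dom.
- exact: dominates_trans dom d1.
- exact: dominates_trans d2 exp_dominates_growth.
Qed.

Lemma exponential_of_expanding n (d : R) : 0 < d ->
  (forall k, (1 + d) * gamma k <= gamma (k + n.+1)%N) ->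
  dominates gamma (fun k => expR k%:R).
Proof.
move=> d0 expd.
have gamma_ge k : (1 + d) ^+ k <= gamma (n.+1 * k)%N.
  elim: k => [|k IHk]; first by rewrite expr0 ler1n ball_size_gt0.
  rewrite exprS mulnS addnC; apply: le_trans (expd _).
  by rewrite ler_wpM2l // addr_ge0 // ltW.
have [p ep] : exists p, expR 1 <= (1 + d) ^+ p.
  (* By Bernoulli's inequality it suffices that [1 + p * d >= expR 1], which holds once [p] exceeds
     [expR 1 / d]. *)
  exists (Num.truncn (expR 1 / d)).+1.
  have le_bern q : 1 + q%:R * d <= (1 + d) ^+ q.
    elim: q => [|q IHq]; first by rewrite mul0r addr0.
    rewrite exprS; apply: (@le_trans _ _ ((1 + d) * (1 + q%:R * d))); last first.
      by rewrite ler_wpM2l // addr_ge0 // ltW.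
    rewrite -natr1 2!mulrDl !mul1r mulrDr mulr1 -addrA lerD2l.
    by rewrite lerD2l lerDl !mulr_ge0 // ltW.
  apply: le_trans (le_bern _); rewrite -lerBlDl.
  rewrite -ler_pdivrMr // (le_trans _ (ltW (truncnS_gt _))) //.
  by rewrite ler_wpM2r ?invr_ge0 ?(ltW d0) // gerBl.
have p0 : (0 < p)%N.
  by case: p ep => // ; rewrite expr0 leNgt expR_gt1 ltr01.
exists (n.+1 * p)%N; first by rewrite muln_gt0.
move=> k _; apply: (@le_trans _ _ (gamma (n.+1 * p * k)%N)).
  rewrite -mulnA; apply: le_trans (gamma_ge _).
  rewrite -[k%:R]mulr1 expRM_natl exprM lerXn2r // nnegrE ?expR_ge0 //.
  by rewrite exprn_ge0 // addr_ge0 // ltW.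
by rewrite ler_peMl ?ler0n // ler1n muln_gt0.
Qed.

Lemma thin_shell n : subexponential_growth R C ->
  exists k, gamma (k + n)%N - gamma k <= n.+1%:R^-1 * gamma k.
Proof.
move=> sub; apply: contrapT => /forallNP thick.
apply: (subexponential_not_dominates sub).
(* The radius step is enlarged from [n] to [n.+1], so that it is positive even for [n = 0];
   monotonicity of balls preserves the lower bound. *)
apply: (@exponential_of_expanding n n.+1%:R^-1) => [|k]; first by rewrite invr_gt0.
have /negP := thick k; rewrite -ltNge ltrBrDr mulrDl mul1r addrC => /ltW le1.
apply: le_trans le1 _; rewrite ler_nat.
apply: card_subset; first exact: finite_ball.
by apply: sub_ball; rewrite leq_add2l.
Qed.

End Growth.
End Balls.
End CellSpace.

(** * Invariance of the limit mean *)

Theorem theorem11p1 (R : realType) (C : cell_space) :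
  finitely_right_generated C ->
  finite_set (stabiliser C) ->
  subexponential_growth R C ->
  right_amenable R C.
Proof.
move=> fgen stabf sub.
have [S S_fsrg] := finite_symmetric_generation fgen stabf.
have [k kP] := boolp.choice (fun n => thin_shell S_fsrg n sub).
pose F n := ball S (k n).
have Ff n : finite_set (F n) by exact: finite_ball.
have F0 n : F n !=set0 by exists (origin C); exact: ball_origin.
have [mu [mu_fap mu_eq]] := density_limit_mean R Ff F0.
exists mu => // s sC A fi; apply: mu_eq.
have [n0 n0P] := bounded_displacement S_fsrg stabf sC.
apply: (norm_cvg0P _).1.
(* [harmonic] is the relative shell size [n.+1%:R^-1] granted by [thin_shell]. *)
apply: (@squeeze_cvgr _ _ _ _ (fun=> 0%R) harmonic).
- near=> n; rewrite normr_ge0 /=.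
  (* From here on the shell is at least as wide as the displacement by [s], so points of [F n] stay
     in the larger ball, and so do points sent into [F n]. *)
  have n0n : (n0 <= n)%N by near: n; exact: nbhs_infty_ge.
  have [] := @card_image_setI _ (fun m => ract m s) A (F n) (ball S (k n + n)%N).
  - exact: finite_ball.
  - by apply: sub_ball; exact: leq_addr.
  - exact: fi.
  - move=> m _ Fm; have [[j jn rj] _] := n0P m.
    by apply: ball_reach rj (leq_trans jn n0n).
  - move=> m _ Fm; have [_ [j jn rj]] := n0P m.
    by apply: ball_reach rj (leq_trans jn n0n).
  set a := card _; set b := card (_ @` _ `&` _) => le1 le2.
  have le_sz : (card (F n) <= card (ball S (k n + n)%N))%N.
    apply: card_subset; first exact: finite_ball.
    by apply: sub_ball; exact: leq_addr.
  rewrite /density -/a -/b -mulrBl normrM normfV normr_nat.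
  rewrite ler_pdivrMr; last exact: (card_F_gt0 R Ff F0).
  apply: le_trans (kP n); rewrite /growth -(natrB _ le_sz).
  by rewrite ler_distl lerBlDr -!natrD !ler_nat le1 le2.
- exact: cvg_cst.
- exact: cvg_harmonic.
Unshelve. all: by end_near.
Qed.
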